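(* For every $k\ge0$ and every odd-wedge pattern $\tau\in\mathfrak S_{2k+1}(132)$, $$\mathfrak E_\tau(x)=\frac12\bigl(R_{2k+1}(x)+xR_k(x^2)+1\bigr)\quad\text{and}\quad \mathfrak O_\tau(x)=\frac12\bigl(R_{2k+1}(x)-xR_k(x^2)-1\bigr).$$
   Context: $\mathfrak S_n$ is the set of permutations of $\{1,\dots,n\}$ (for $n=0$, the empty permutation, which is even). A permutation avoids a pattern $\tau$ of length $\ell$ if none of its length-$\ell$ subsequences is order-isomorphic to $\tau$; $\mathfrak S_n(132)$ is the set of $132$-avoiding permutations in $\mathfrak S_n$. $\mathfrak E_\tau(x)$ (resp. $\mathfrak O_\tau(x)$) is the ordinary generating function in $n$ for the number of even (resp. odd) permutations in $\mathfrak S_n$, $n\ge0$, avoiding both $132$ and $\tau$. A permutation $\tau\in\mathfrak S_\ell$ is a wedge pattern if it can be written as $\tau=(\tau^1,\rho^1,\dots,\tau^r,\rho^r)$ where each $\tau^i$ is nonempty, $(\tau^1,\tau^2,\dots,\tau^r)=(s+1,s+2,\dots,\ell)$ for some $s\ge0$, and $(\rho^1,\dots,\rho^r)$ is a layered permutation of $1,\dots,s$ with layers $\rho^i$: each $\rho^i$ is a (possibly empty) increasing word, and all entries of $\rho^i$ are greater than all entries of $\rho^{j}$ for $i<j$. For example $645783912$ and $456378129$ are wedge patterns. It is an odd-wedge pattern if such a representation exists in which, for every $p=1,\dots,r$, the length of $(\tau^1,\rho^1,\dots,\tau^p,\rho^p)$ is odd. For example $23145$ and $34251$ are odd-wedge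 patterns. $U_r$ is the Chebyshev polynomial of the second kind: $U_0(t)=1$, $U_1(t)=2t$, $U_r(t)=2tU_{r-1}(t)-U_{r-2}(t)$. For $k\ge1$, $R_k(x)=\dfrac{U_{k-1}\left(\frac1{2\sqrt x}\right)}{\sqrt x\,U_k\left(\frac1{2\sqrt x}\right)}$, a rational function of $x$, and $R_0(x)=0$; equivalently $R_k(x)=1/(1-xR_{k-1}(x))$ for $k\ge1$. *)

(* Defs.v *)
From HB Require Import structures.
From mathcomp Require Import all_boot all_order all_algebra all_fingroup.
Set Implicit Arguments.
Unset Strict Implicit.
Unset Printing Implicit Defensive.
Import GRing.Theory.
Local Open Scope nat_scope.

(* Permutations are elements of 'S_n acting on {0, ..., n-1}; [word] is the
   usual one-line notation with values in {1, ..., n}. *)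
Definition word n (s : 'S_n) : seq nat := [seq (s i).+1 | i <- enum 'I_n].

Definition contains l n (t : 'S_l) (s : 'S_n) : bool :=
  [exists f : {ffun 'I_l -> 'I_n},
    [forall i : 'I_l, forall j : 'I_l, (i < j) ==> (f i < f j)] &&
    [forall i : 'I_l, forall j : 'I_l, (s (f i) < s (f j)) == (t i < t j)]].

Definition avoids l n (t : 'S_l) (s : 'S_n) : bool := ~~ contains t s.

(* One-line notation 1 3 2. *)
Definition p132 : 'S_3 := tperm (inord 1) (inord 2).

(* A representation (tau^1, rho^1, ..., tau^r, rho^r) is encoded as the
   sequence of pairs (tau^i, rho^i). *)
Definition concat_blocks (d : seq (seq nat * seq nat)) : seq nat :=
  flatten [seq b.1 ++ b.2 | b <- d].

Definition is_wedge_repr l (t : 'S_l) (d : seq (seq nat * seq nat)) : Prop :=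
  [/\ word t = concat_blocks d,
      all (fun b => b.1 != [::]) d
    & exists s, [/\ s <= l,
        flatten (unzip1 d) = iota s.+1 (l - s),
        perm_eq (flatten (unzip2 d)) (iota 1 s),
        all (sorted ltn) (unzip2 d)
      & pairwise (allrel (fun a b => b < a)) (unzip2 d)]].

Definition wedge_pattern l (t : 'S_l) : Prop := exists d, is_wedge_repr t d.

Definition odd_wedge_pattern l (t : 'S_l) : Prop :=
  exists d, is_wedge_repr t d /\
    forall p, 1 <= p <= size d -> odd (size (concat_blocks (take p d))).

Local Open Scope ring_scope.

(* Formal power series over the rationals, as coefficient sequences. *)
Definition evenGF l (t : 'S_l) : nat -> rat := fun n =>
  #|[set s : 'S_n | [&& avoids p132 s, avoids t s & ~~ odd_perm s]]|%:R.

Definition oddGF l (t : 'S_l) : nat -> rat := fun n =>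
  #|[set s : 'S_n | [&& avoids p132 s, avoids t s & odd_perm s]]|%:R.

(* The value U_r(t) of the Chebyshev polynomial of the second kind. *)
Fixpoint chebU (F : comNzRingType) (r : nat) (t : F) {struct r} : F :=
  match r with
  | 0 => 1
  | r1.+1 => match r1 with
             | 0 => 2 * t
             | r2.+1 => 2 * t * chebU r1 t - chebU r2 t
             end
  end.

(* The field Q(sqrt x), i.e. rational functions over Q in the indeterminate
   sqrt x; it contains Q(x), where x is the square of that indeterminate. *)
Definition Qsqrtx := {fraction {poly rat}}.
Definition sqrtx : Qsqrtx := tofrac 'X.
Definition varx : Qsqrtx := sqrtx ^+ 2.

(* [Rcheb k s] is R_k(s ^+ 2), the square root of the argument being s. *)
Definition Rcheb (k : nat) (s : Qsqrtx) : Qsqrtx :=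
  if k is k1.+1 then
    chebU k1 (2 * s)^-1 / (s * chebU k (2 * s)^-1)
  else 0.

Definition poly_at_x (p : {poly rat}) : Qsqrtx := tofrac (p \Po 'X^2).

(* The power series a(x) equals the rational function f: f = p(x) / q(x) for
   polynomials p and q != 0 with q(x) a(x) = p(x) as power series. *)
Definition series_eq (a : nat -> rat) (f : Qsqrtx) : Prop :=
  exists p q : {poly rat},
    [/\ q != 0,
        f = poly_at_x p / poly_at_x q
      & forall n, \sum_(i < n.+1) q`_i * a (n - i)%N = p`_n].

(* Main.v *)
From HB Require Import structures.
Require Import Defs.
From mathcomp Require Import all_boot all_order all_algebra all_fingroup.
From mathcomp Require Import boolp ring zify.
Set Implicit Arguments.
Unset Strict Implicit.
Unset Printing Implicit Defensive.
Import GRing.Theory.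
Local Open Scope nat_scope.

(** Write a nonempty 132-avoiding permutation, in one-line notation, as u' N v with N its
    maximum.  Avoidance of 132 forces every letter of u' above every letter of v, so
    the word is glued from two smaller 132-avoiding words u and v, and conversely any
    two glue ([av132S]).  With a and b the lengths of u and v, the inversion numbers
    add up with a correction (a + 1) b ([inversions_glue]).

    A nonempty wedge pattern tau factors as theta l rho with l its maximum and rho an
    increasing word below theta.  An occurrence of tau in u' N v lies in u', or in v,
    or puts theta in u' and rho in v: a cut of tau between a larger left part and a
    smaller right part can only fall just after l ([occurs_peak]).  Counting avoiders
    by length therefore gives, for the generating functions T,
       T_tau = 1 + x (T_theta T_tau + (T_tau - T_theta) T_rho),
    and weighting each word by its sign multiplies the (a, b) term by
    (-1)^((a + 1) b), which depends on the parities of a and b only.  Splitting the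
    signed series into its even-degree part E and its odd-degree part O turns the
    signed recurrence into two linear equations for E_tau and O_tau.

    Odd-wedge patterns are among the words built up from the empty word by passing from
    theta to theta l rho when rho is empty or theta and rho have lengths of equal
    parity ([odd_wedge_word]).  For all such words, with y = x^2 and A = R_j(y), induction gives
    - T = R_n(x) in length n ([expands_total]);
    - E = 1 and O = x A in odd length 2 j + 1,
      E = A / (1 + y A^2) and O = x A E in even length 2 j ([expands_parts]).
    The verification reduces to the addition formulas for R ([ratio_addS],
    [ratio_add]).  The even and the odd avoiders are counted by half the sum and half
    the difference of T and E + O, which is the theorem.

    To pass between series and rational functions, [expands a f] says that the
    series a is the expansion of f; it is stable under ring operations and under
    division by a series with nonzero constant term, and that constant term also
    makes the denominator nonzero as a rational function. *)

(** * Pattern containment for words *)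

(** Only the pairs of positions i < j are compared, and only in one direction: for
    words without repetition this determines the relative order of all letters, and
    it makes the relation compatible with concatenation. *)
Definition order_iso (t w : seq nat) : bool :=
  (size t == size w) &&
  pairwise (fun p q => (p.2 < q.2) == (p.1 < q.1)) (zip t w).

Definition occurs (t w : seq nat) : bool :=
  [exists m : (size w).-tuple bool, order_iso t (mask m w)].

Lemma occursP t w :
  reflect (exists2 z, subseq z w & order_iso t z) (occurs t w).
Proof.
apply: (iffP existsP) => [[m tm]|[z /subseqP[m sm ->] tz]].
  by exists (mask m w); first exact: mask_subseq.
by move/eqP: sm => sm; exists (Tuple sm).
Qed.

Lemma order_iso_size t w : order_iso t w -> size t = size w.
Proof. by case/andP=> /eqP. Qed.

(** The part of [order_iso] that compares a letter of the left factor with a letter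
    of the right factor. *)
Definition same_cross (t1 t2 w1 w2 : seq nat) : bool :=
  allrel (fun p q => (p.2 < q.2) == (p.1 < q.1)) (zip t1 w1) (zip t2 w2).

Lemma order_iso_cat t1 t2 w1 w2 : size t1 = size w1 ->
  order_iso (t1 ++ t2) (w1 ++ w2) =
    [&& order_iso t1 w1, order_iso t2 w2 & same_cross t1 t2 w1 w2].
Proof.
move=> st; rewrite /order_iso !size_cat st eqn_add2l zip_cat // pairwise_cat eqxx /=.
by rewrite /same_cross [in LHS]andbCA; case: (size t2 == _); rewrite /= ?andbF // andbC -andbA.
Qed.

Definition allgt (u v : seq nat) : bool := allrel (fun a b => b < a) u v.

Lemma allgtP u v : reflect {in u & v, forall a b, b < a} (allgt u v).
Proof. exact: allrelP. Qed.
Arguments allgtP {u v}.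

(** How inequalities between letters of a word are read in its pattern. *)
Lemma same_cross_mem t1 t2 w1 w2 a b : size t1 = size w1 -> size t2 = size w2 ->
  same_cross t1 t2 w1 w2 -> a \in t1 -> b \in t2 ->
  exists a' b', [/\ a' \in w1, b' \in w2 & (a' < b') = (a < b)].
Proof.
move=> s1 s2 /allrelP cr.
rewrite -(unzip1_zip (eq_leq s1)) -(unzip1_zip (eq_leq s2)).
move=> /mapP[p pin ->] /mapP[q qin ->]; exists p.2, q.2; split.
- by rewrite -(unzip2_zip (eq_leq (esym s1))) map_f.
- by rewrite -(unzip2_zip (eq_leq (esym s2))) map_f.
- exact: (eqP (cr _ _ pin qin)).
Qed.

Lemma subseq_catP (z x y : seq nat) : subseq z (x ++ y) ->
  exists z1 z2, [/\ z = z1 ++ z2, subseq z1 x & subseq z2 y].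
Proof.
move=> /subseqP[m sm ->]; rewrite size_cat in sm.
exists (mask (take (size x) m) x), (mask (drop (size x) m) y).
rewrite -mask_cat ?cat_take_drop ?mask_subseq //.
by rewrite size_takel // sm leq_addr.
Qed.

Lemma cat_eq_cat (s1 s2 t1 t2 : seq nat) : s1 ++ s2 = t1 ++ t2 ->
  exists m, (s1 = t1 ++ m /\ t2 = m ++ s2) \/ (t1 = s1 ++ m /\ s2 = m ++ t2).
Proof.
elim: s1 t1 => [|a s1 IH] [|b t1] /=.
- by move=> ->; exists [::]; left.
- by move=> ->; exists (b :: t1); right.
- by move=> <-; exists (a :: s1); left.
by case=> -> /IH[m [[-> ->]|[-> ->]]]; exists m; [left|right].
Qed.

Lemma order_iso_catP t z1 z2 : order_iso t (z1 ++ z2) ->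
  exists t1 t2, [/\ t = t1 ++ t2, size t1 = size z1, size t2 = size z2 &
    [&& order_iso t1 z1, order_iso t2 z2 & same_cross t1 t2 z1 z2]].
Proof.
move=> tz; have st := order_iso_size tz.
exists (take (size z1) t), (drop (size z1) t).
have s1 : size (take (size z1) t) = size z1.
  by rewrite size_takel // st size_cat leq_addr.
rewrite -order_iso_cat // cat_take_drop; split=> //.
by rewrite size_drop st size_cat addKn.
Qed.

Lemma occurs_sub t x y : subseq x y -> occurs t x -> occurs t y.
Proof.
move=> xy /occursP[z zx tz]; apply/occursP; exists z => //.
exact: subseq_trans zx xy.
Qed.

Lemma occurs_catl t1 t2 w : occurs (t1 ++ t2) w -> occurs t1 w.
Proof.
move=> /occursP[z zw tz]; apply/occursP; exists (take (size t1) z).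
  by apply: subseq_trans zw; rewrite -{2}(cat_take_drop (size t1) z) prefix_subseq.
have st := order_iso_size tz.
move: tz; rewrite -{1}(cat_take_drop (size t1) z) order_iso_cat; first by case/andP.
by rewrite size_takel // -st size_cat leq_addr.
Qed.

Lemma occurs_catr t1 t2 w : occurs (t1 ++ t2) w -> occurs t2 w.
Proof.
move=> /occursP[z zw tz]; apply/occursP; exists (drop (size t1) z).
  by apply: subseq_trans zw; rewrite -{2}(cat_take_drop (size t1) z) suffix_subseq.
have st := order_iso_size tz.
move: tz; rewrite -{1}(cat_take_drop (size t1) z) order_iso_cat.
  by case/and3P.
by rewrite size_takel // -st size_cat leq_addr.
Qed.

Lemma subseq_consP (z : seq nat) n v : subseq z (n :: v) ->
  subseq z v \/ exists2 z', z = n :: z' & subseq z' v.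
Proof.
case: z => [|a z] /=; first by left; rewrite sub0seq.
by case: eqP => [->|_] ?; [right; exists z|left].
Qed.

Lemma order_iso_132P z :
  reflect (exists a b c, z = [:: a; b; c] /\ [&& a < b, a < c & c <= b])
    (order_iso [:: 1; 3; 2] z).
Proof.
apply: (iffP idP) => [|[a [b [c [-> /and3P[ab ac cb]]]]]]; last first.
  by rewrite /order_iso /= ab ac [b < c]ltnNge cb.
case: z => [|a [|b [|c [|]]]] // iso; exists a, b, c; split=> //.
by move: iso; rewrite /order_iso /= [b < c]ltnNge; case: (a < b) (a < c) (c <= b) => [] [] [].
Qed.

Section Peak.
Variables (x v : seq nat) (n : nat).
Hypotheses (xn : all (ltn^~ n) x) (vn : all (ltn^~ n) v) (xv : allgt x v).

(** The factor r is increasing and l exceeds everything, so a cut of t l r between a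
    larger left part and a smaller right part, both nonempty, falls just after l. *)
Lemma occurs_peak t l r :
    all (ltn^~ l) t -> all (ltn^~ l) r -> allgt t r -> sorted ltn r ->
  occurs (t ++ l :: r) (x ++ n :: v) =
  [|| occurs (t ++ l :: r) x, occurs (t ++ l :: r) v | occurs t x && occurs r v].
Proof.
move=> tl rl tr sr; apply/idP/or3P; last first.
  case=> [||/andP[/occursP[z1 z1x tz1] /occursP[z2 z2v rz2]]].
  - by apply: occurs_sub; apply: prefix_subseq.
  - by apply: occurs_sub; apply: (subseq_trans (subseq_cons v n)); apply: suffix_subseq.
  apply/occursP; exists (z1 ++ n :: z2).
    by apply: cat_subseq => //=; rewrite eqxx.
  have s1 := order_iso_size tz1; have s2 := order_iso_size rz2.
  have sub1 a : a \in z1 -> a \in x by exact: (mem_subseq z1x).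
  have sub2 a : a \in z2 -> a \in v by exact: (mem_subseq z2v).
  have mz (u w : seq nat) p : p \in zip u w -> p.1 \in u /\ p.2 \in w.
    elim: u w => [|a u IHu] [|b w] //=; rewrite !inE => /orP[/eqP->|/IHu[-> ->]].
      by rewrite !eqxx.
    by rewrite !orbT.
  rewrite -(cat1s l) -(cat1s n) !order_iso_cat // tz1 rz2 /=.
  rewrite /order_iso /= /same_cross; apply/andP; split; apply/allrelP => -[a b] [c d] /mz[].
    rewrite /= !inE => /eqP-> /eqP-> /mz[/= cr /sub2 dv].
    by have := allP vn _ dv; have := allP rl _ cr => /=; clear; lia.
  move=> /= ta /sub1 bx; rewrite inE => /orP[/eqP[-> ->]|/mz[/= cr /sub2 dv]].
    by have /= -> := allP xn _ bx; have /= -> := allP tl _ ta.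
  have := allgtP xv _ _ bx dv; have := allgtP tr _ _ ta cr; clear; lia.
move=> /occursP[z /subseq_catP[z1 [z' [-> z1x z'v]]]].
move=> /order_iso_catP[t1 [t2 [E s1 s2 /and3P[tz1 tz2 cr]]]].
have sub1 a : a \in z1 -> a \in x by exact: (mem_subseq z1x).
have [{}z'v|[z2 z'E z2v]] := subseq_consP z'v; last first.
  have sub2 a : a \in z2 -> a \in v by exact: (mem_subseq z2v).
  move: s2 tz2 cr E; rewrite z'E; case: t2 => [//|n' t2] [s2] tz2 cr E.
  move: tz2; rewrite -(cat1s n') -(cat1s n) order_iso_cat // => /and3P[_ tz2 cr2].
  have good : t1 = t -> t2 = r -> occurs t x && occurs r v.
    by move=> <- <-; apply/andP; split; apply/occursP; [exists z1|exists z2].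
  have nt2 b : b \in t2 -> ~~ (n' < b).
    move=> bt2; have [|a' [b' [/=]]] := same_cross_mem _ s2 cr2 (mem_head _ _) bt2 => //.
    by rewrite inE => /eqP-> /sub2 /(allP vn) /= + <-; clear; lia.
  have nt1 a : a \in t1 -> a < n'.
    have cr1 : same_cross t1 [:: n'] z1 [:: n].
      apply/allrelP => p q pin; rewrite inE => /eqP->.
      by move/allrelP: cr; apply => //; apply: mem_head.
    move=> at1; have [//|a' [b' [/sub1 a'x]]] := same_cross_mem s1 _ cr1 at1 (mem_head _ _).
    by rewrite inE => /eqP-> <-; apply: (allP xn).
  (* Here n is used, by the letter n'. Both n and l are maxima, so n' is l. *)
  have [[|y m] [[tE /=]|[t1E /=]]] := cat_eq_cat E.
  - by rewrite cats0 in tE; case=> _ tr2; apply: Or33; apply: good.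
  - by rewrite cats0 in t1E; case=> _ tr2; apply: Or33; apply: good.
  - case=> ny t2E; have := nt2 l; rewrite t2E mem_cat mem_head orbT => /(_ isT).
    by have /= -> := allP tl n'; rewrite // tE mem_cat ny mem_head orbT.
  - case=> ly rE; have := nt1 l; rewrite t1E mem_cat ly mem_head orbT => /(_ isT).
    have /= := allP rl n'; rewrite rE mem_cat mem_head orbT => /(_ isT).
    by rewrite -ly; clear; lia.
(* From here on n is not used, and t1 lies above t2. *)
have sub2 a : a \in z' -> a \in v by exact: (mem_subseq z'v).
have noup a b : a \in t1 -> b \in t2 -> ~~ (a < b).
  move=> at1 bt2; have [a' [b' [/sub1 a'x /sub2 b'v <-]]] := same_cross_mem s1 s2 cr at1 bt2.
  by have := allgtP xv _ _ a'x b'v; clear; lia.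
case: t1 => [|a t1] in s1 tz1 cr E noup *.
  move: s1 => /esym/size0nil z1E; apply: Or32; apply/occursP; exists z' => //.
  by rewrite E.
case: t2 => [|b t2] in s2 tz2 cr E noup *.
  rewrite E cats0; apply: Or31; apply/occursP; exists z1 => //.
have [m [[tE t2E]|[t1E rE]]] := cat_eq_cat E.
  have := noup a l (mem_head _ _); rewrite t2E mem_cat mem_head orbT => /(_ isT).
  by have /= -> := allP tl a; rewrite // tE mem_head.
case: m => [|y m] /= in t1E rE.
  rewrite cats0 in t1E; have := noup a l (mem_head _ _); rewrite -rE mem_head => /(_ isT).
  by have /= -> := allP tl a; rewrite // -t1E mem_head.
case: rE => ly; case: m => [|c m] /= in t1E * => rE.
  apply: Or33; apply/andP; split.
    have : occurs (a :: t1) x by apply/occursP; exists z1.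
    by rewrite t1E; apply: occurs_catl.
  by rewrite rE; apply/occursP; exists z'.
move: sr; rewrite rE /= => /(order_path_min ltn_trans)/allP/(_ b).
rewrite mem_cat mem_head orbT => /(_ isT) cb.
have := noup c b; rewrite t1E mem_cat !inE !eqxx !orbT => /(_ isT isT).
by rewrite cb.
Qed.

(** A 132 starting in x ends in a larger letter, hence not in v; and n cannot be its
    last letter, while a 132 through n as 3 would need its 2 in v. *)
Lemma occurs_peak_132 :
  occurs [:: 1; 3; 2] (x ++ n :: v) =
  occurs [:: 1; 3; 2] x || occurs [:: 1; 3; 2] v.
Proof.
apply/idP/orP; last first.
  case; first by apply: occurs_sub; apply: prefix_subseq.
  by apply: occurs_sub; apply: (subseq_trans (subseq_cons v n)); apply: suffix_subseq.
move=> /occursP[z zw iso]; have /order_iso_132P[a [b [c [zE /and3P[ab ac cb]]]]] := iso.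
move: zw => /subseq_catP[z1 [z2 [z12 z1x z2v]]].
have sub1 d : d \in z1 -> d \in x by exact: (mem_subseq z1x).
have below p q : p \in x -> q \in v -> q < p by exact: (allgtP xv).
have vn' q : q \in v -> q < n by exact: (allP vn).
have xn' q : q \in x -> q < n by exact: (allP xn).
have sub2 d : d \in z2 -> d = n \/ d \in v.
  by move/(mem_subseq z2v); rewrite inE => /orP[/eqP|]; [left|right].
rewrite zE in z12; case: z1 => [|a' [|b' [|c' z1]]] /= in z12 z1x sub1.
- have [{}z2v|[z' z'E z'v]] := subseq_consP z2v.
    by right; apply/occursP; exists z2; rewrite // -z12 -zE.
  move: z12; rewrite z'E => -[an z'bc]; have := vn' b; rewrite -an => bn.
  have: b < a by apply: bn; apply: (mem_subseq z'v); rewrite -z'bc mem_head.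
  by rewrite ltnNge ltnW.
- case: z12 => aa' z2E; have ax : a \in x by apply: sub1; rewrite aa' mem_head.
  have [|cn|cv] := sub2 c; first by rewrite -z2E !inE eqxx orbT.
    have [|bn|/(below _ _ ax)] := sub2 b; first by rewrite -z2E mem_head.
      move: z2v; rewrite -z2E bn /= eqxx sub1seq => cv.
      by have := vn' c cv; rewrite cn ltnn.
    by rewrite ltnNge ltnW.
  by have := below _ _ ax cv; rewrite ltnNge ltnW.
- case: z12 => aa' bb' z2E; have ax : a \in x by apply: sub1; rewrite aa' mem_head.
  have bx : b \in x by apply: sub1; rewrite bb' !inE eqxx orbT.
  have [|cn|cv] := sub2 c; first by rewrite -z2E mem_head.
    by have := xn' b bx; rewrite ltnNge -cn cb.
  by have := below _ _ ax cv; rewrite ltnNge ltnW.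
- case: z12 => aa' bb' cc' /esym; case: z1 z1x sub1 => //= z1x sub1 _.
  by left; apply/occursP; exists z => //; rewrite zE aa' bb' cc'.
Qed.
End Peak.

Lemma avoids132_allgt x v n : all (ltn^~ n) x -> all (ltn^~ n) v ->
  uniq (x ++ v) -> ~~ occurs [:: 1; 3; 2] (x ++ n :: v) -> allgt x v.
Proof.
move=> xn vn uxv no132; apply/allgtP => a c ax cv; rewrite ltnNge leq_eqVlt.
apply: contra no132 => /orP[/eqP ac|ac].
  by move: uxv; rewrite cat_uniq => /and3P[_ /hasPn/(_ _ cv)/=]; rewrite -ac ax.
apply/occursP; exists [:: a; n; c].
  rewrite -cat1s; apply: cat_subseq; first by rewrite sub1seq.
  by rewrite /= eqxx sub1seq.
have /= an := allP xn _ ax; have /= cn := allP vn _ cv.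
by apply/order_iso_132P; exists a, n, c; rewrite an ac ltnW.
Qed.

Lemma order_iso_map f t z : {mono f : a b / a < b} ->
  order_iso t (map f z) = order_iso t z.
Proof.
move=> fm; rewrite /order_iso size_map; congr (_ && _).
have -> : zip t (map f z) = map (fun p => (p.1, f p.2)) (zip t z).
  by elim: t z => [|a t IH] [|b z] //=; rewrite IH.
by rewrite pairwise_map; apply: eq_pairwise => p q /=; rewrite fm.
Qed.

Lemma occurs_map f t w : {mono f : a b / a < b} -> occurs t (map f w) = occurs t w.
Proof.
move=> fm; apply/occursP/occursP => [[z /subseqP[m _ ->]]|[z zw tz]].
  by rewrite -map_mask order_iso_map // => tz; exists (mask m w) => //; apply: mask_subseq.
by exists (map f z); rewrite ?order_iso_map // map_subseq.
Qed.

Lemma occurs_nil w : occurs [::] w.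
Proof. by apply/occursP; exists [::]; rewrite ?sub0seq. Qed.

Lemma occurs_small t w : size w < size t -> ~~ occurs t w.
Proof.
move=> sw; apply/occursP => -[z /size_subseq zw /order_iso_size st].
by move: sw; rewrite st ltnNge zw.
Qed.

(** * Decomposition of 132-avoiding words at their maximum *)

Definition av132 n : seq (seq nat) :=
  [seq w <- permutations (iota 1 n) | ~~ occurs [:: 1; 3; 2] w].

(** The letters of u are raised above those of v, so that gluing words on {1, ..., a}
    and {1, ..., b} gives a word on {1, ..., a + b + 1}. *)
Definition glue (u v : seq nat) : seq nat :=
  map (addn (size v)) u ++ (size u + size v).+1 :: v.

Lemma mem_av132 n w :
  (w \in av132 n) = ~~ occurs [:: 1; 3; 2] w && perm_eq w (iota 1 n).
Proof. by rewrite mem_filter mem_permutations. Qed.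

Lemma av132_uniq n : uniq (av132 n).
Proof. by rewrite filter_uniq // permutations_uniq. Qed.

Lemma av132_size n w : w \in av132 n -> size w = n.
Proof. by rewrite mem_av132 => /andP[_ /perm_size]; rewrite size_iota. Qed.

Lemma av132_mem n w a : w \in av132 n -> (a \in w) = (0 < a <= n).
Proof.
by rewrite mem_av132 => /andP[_ /perm_mem->]; rewrite mem_iota add1n ltnS.
Qed.

Lemma addn_mono k : {mono addn k : a b / a < b}.
Proof. by move=> a b; rewrite ltn_add2l. Qed.

Section Glue.
Variables (a b : nat) (u v : seq nat).
Hypotheses (ua : u \in av132 a) (vb : v \in av132 b).
Local Notation x := (map (addn (size v)) u).
Local Notation N := (size u + size v).+1.

Lemma glue_lt_left : all (ltn^~ N) x.
Proof.
apply/allP => _ /mapP[c cu ->]; rewrite /= (av132_size ua) ltnS addnC leq_add2r.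
by move: cu; rewrite (av132_mem _ ua) => /andP[].
Qed.

Lemma glue_lt_right : all (ltn^~ N) v.
Proof.
apply/allP => c; rewrite (av132_mem _ vb) /= (av132_size vb) ltnS.
by case/andP=> _ cb; apply: leq_trans cb (leq_addl _ _).
Qed.

Lemma glue_allgt : allgt x v.
Proof.
apply/allgtP => _ d /mapP[c cu ->]; rewrite (av132_mem _ vb) (av132_size vb).
move=> /andP[_ db]; move: cu; rewrite (av132_mem _ ua) => /andP[c0 _].
by apply: leq_ltn_trans db _; rewrite -addn1 leq_add2l.
Qed.

Lemma glue_av132 : glue u v \in av132 (a + b).+1.
Proof.
rewrite mem_av132 /glue occurs_peak_132 ?glue_lt_left ?glue_lt_right ?glue_allgt //.
rewrite (occurs_map _ _ (addn_mono _)).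
move: ua vb; rewrite !mem_av132 => /andP[/negPf-> pu] /andP[/negPf-> pv]; rewrite orbF andTb.
have su := av132_size ua; have sv := av132_size vb.
have -> : iota 1 (a + b).+1 = iota 1 b ++ map (addn b) (iota 1 a) ++ [:: (a + b).+1].
  rewrite -iotaDl [b + 1]addnC catA -iotaD [b + a]addnC.
  by rewrite -[in LHS](addn1 (a + b)) (iotaD _ (a + b)) add1n.
rewrite su sv perm_sym perm_catC -catA perm_sym perm_cat ?perm_map //=.
by rewrite perm_cons.
Qed.

Lemma glue_index : index N (glue u v) = size u.
Proof.
rewrite /glue index_cat ifN; first by rewrite /= eqxx addn0 size_map.
by apply/negP => /(allP glue_lt_left) /=; rewrite ltnn.
Qed.
End Glue.

(** The position of the maximum recovers the length of u. *)
Lemma glue_inj a b a' b' u v u' v' :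
  u \in av132 a -> v \in av132 b -> u' \in av132 a' -> v' \in av132 b' ->
  a + b = a' + b' -> glue u v = glue u' v' -> [/\ a = a', u = u' & v = v'].
Proof.
move=> ua vb ua' vb' ab E.
have := glue_index v ua; have := glue_index v' ua'.
rewrite E (av132_size ua) (av132_size vb) (av132_size ua') (av132_size vb') ab => -> aa.
have bb : b = b' by apply: (@addnI a); rewrite ab aa.
move/eqP: E; rewrite /glue eqseq_cat; last first.
  by rewrite !size_map (av132_size ua) (av132_size ua') aa.
rewrite (av132_size vb) (av132_size vb') bb => /andP[/eqP uu /eqP[_ vv]].
by split=> //; apply: inj_map uu; apply: addnI.
Qed.

(** Both sides of [E] below are sorted rearrangements of the same letters. *)
Lemma allgt_perm_iota x v n : perm_eq (x ++ v) (iota 1 n) -> allgt x v ->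
  perm_eq v (iota 1 (size v)) /\ perm_eq x (iota (size v).+1 (size x)).
Proof.
move=> pxv xv.
have sn : size v + size x = n by move/perm_size: pxv; rewrite size_cat size_iota addnC.
have E : sort leq v ++ sort leq x = iota 1 (size v) ++ iota (size v).+1 (size x).
  rewrite -[(size v).+1]add1n -iotaD sn; apply: (sorted_eq leq_trans anti_leq).
  - rewrite (sorted_pairwise leq_trans) pairwise_cat -!(sorted_pairwise leq_trans).
    rewrite !(sort_sorted leq_total) !andbT; apply/allrelP => c d.
    by rewrite !mem_sort => cv dx; apply/ltnW/(allgtP xv).
  - exact: iota_sorted.
  - rewrite (perm_trans _ pxv) // perm_sym perm_catC perm_cat //.
      by rewrite perm_sym perm_sort.
    by rewrite perm_sym perm_sort.
move/eqP: E; rewrite eqseq_cat ?size_sort ?size_iota // => /andP[/eqP Ev /eqP Ex].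
by rewrite -Ev -Ex; split; rewrite perm_sym perm_sort.
Qed.

Lemma av132S_unglue n w : w \in av132 n.+1 -> exists a u v,
  [/\ a <= n, u \in av132 a, v \in av132 (n - a) & w = glue u v].
Proof.
move=> wav; have Nw : n.+1 \in w by rewrite (av132_mem _ wav) leqnn.
move: wav; rewrite mem_av132 => /andP[no132 pw].
case/splitPr: Nw no132 pw => x v no132 pw.
have {}pw : perm_eq (x ++ v) (iota 1 n).
  have E : iota 1 n.+1 = iota 1 n ++ [:: n.+1] by rewrite -[in LHS](addn1 n) iotaD add1n.
  rewrite E perm_sym perm_catC perm_sym -(cat1s _ v) perm_catCA perm_cons in pw; exact: pw.
have lt c : c \in x ++ v -> c < n.+1.
  by rewrite (perm_mem pw) mem_iota add1n => /andP[].
have xn : all (ltn^~ n.+1) x by apply/allP => c cx; apply: lt; rewrite mem_cat cx.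
have vn : all (ltn^~ n.+1) v.
  by apply/allP => c cv; apply: lt; rewrite mem_cat cv orbT.
have uxv : uniq (x ++ v) by rewrite (perm_uniq pw) iota_uniq.
have xv := avoids132_allgt xn vn uxv no132.
have [pv px] := allgt_perm_iota pw xv.
have sn : size x + size v = n by rewrite -size_cat (perm_size pw) size_iota.
pose u := map (subn^~ (size v)) x.
have xE : x = map (addn (size v)) u.
  rewrite -map_comp -[LHS]map_id; apply/eq_in_map => c.
  by rewrite (perm_mem px) mem_iota => /andP[/ltnW vc _] /=; rewrite subnKC.
have su : size u = size x by rewrite size_map.
move: no132; rewrite occurs_peak_132 // negb_or => /andP[nox nov].
exists (size x), u, v; split.
- by rewrite -sn leq_addr.
- rewrite mem_av132 -(occurs_map _ u (addn_mono (size v))) -xE nox /=.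
  move: px; rewrite {1}xE -addn1 iotaDl => pmap.
  by apply: (perm_map_inj (@addnI (size v))).
- by rewrite mem_av132 nov -sn addKn.
- by rewrite /glue su -xE sn.
Qed.

(** The Catalan recurrence, as a rearrangement of lists; sums over 132-avoiding words
    split along it. *)
Lemma av132S n : perm_eq (av132 n.+1)
  [seq glue p.1 p.2 | a <- iota 0 n.+1,
                      p <- [seq (u, v) | u <- av132 a, v <- av132 (n - a)]].
Proof.
apply: uniq_perm => [||w]; first exact: av132_uniq.
  apply: allpairs_uniq_dep => [|a _|]; first exact: iota_uniq.
    by apply: allpairs_uniq; rewrite ?av132_uniq // => -[? ?] [].
  move=> _ _ /allpairsPdep[a [p [+ + ->]]] /allpairsPdep[a' [p' [+ + ->]]] /=.
  rewrite !mem_iota !add0n !ltnS => an /allpairsP[[u v] /= [ua vb ->]].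
  move=> an' /allpairsP[[u' v'] /= [ua' vb' ->]] /= E.
  have [|aa uu vv] := glue_inj ua vb ua' vb' _ E; first by rewrite !subnKC.
  by case: _ / aa ua' vb' an' => *; rewrite uu vv.
apply/idP/allpairsPdep => [/av132S_unglue[a [u [v [an ua vb ->]]]]|].
  exists a, (u, v); split=> //; first by rewrite mem_iota ltnS.
  by apply/allpairsP; exists (u, v).
move=> [a [p [+ /allpairsP[[u v] /= [ua vb ->]] ->]]].
rewrite mem_iota ltnS /= => an; rewrite -[n](subnKC an).
exact: glue_av132.
Qed.

(** * Inversions *)

Fixpoint inversions (w : seq nat) : nat :=
  if w is a :: w' then count (ltn^~ a) w' + inversions w' else 0.

Lemma inversions_cat_allgt x y : allgt x y ->
  inversions (x ++ y) = inversions x + inversions y + size x * size y.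
Proof.
elim: x => [|a x IH] /=; first by rewrite addn0.
rewrite /allgt allrel_consl => /andP[ay xy].
rewrite IH // count_cat mulSn.
have -> : count (ltn^~ a) y = size y by apply/eqP; rewrite -all_count.
by clear; lia.
Qed.

Lemma inversions_rcons_max x n : all (ltn^~ n) x -> inversions (rcons x n) = inversions x.
Proof.
elim: x => [|a x IH] //= /andP[an xn]; rewrite IH // -cats1 count_cat /=.
by rewrite ltnNge ltnW // !addn0.
Qed.

Lemma inversions_map f w : {mono f : a b / a < b} -> inversions (map f w) = inversions w.
Proof.
move=> fm; elim: w => //= a w ->; rewrite count_map; congr (_ + _).
by apply: eq_count => b /=; rewrite fm.
Qed.

Lemma inversions_glue a b u v : u \in av132 a -> v \in av132 b ->
  inversions (glue u v) = inversions u + inversions v + a.+1 * b.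
Proof.
move=> ua vb; rewrite /glue -cat1s catA cats1 inversions_cat_allgt.
  rewrite inversions_rcons_max ?(glue_lt_left v ua) // (inversions_map _ (addn_mono _)).
  by rewrite size_rcons size_map (av132_size ua) (av132_size vb).
rewrite -cats1 /allgt allrel_catl -/(allgt _ _) (glue_allgt ua vb) allrel1l andTb.
exact: glue_lt_right vb.
Qed.

(** * Words of permutations *)

Lemma word_perm n (s : 'S_n) : perm_eq (word s) (iota 1 n).
Proof.
have -> : word s = map (fun i : 'I_n => i.+1) (map s (enum 'I_n)).
  exact: (map_comp (fun i : 'I_n => i.+1) s (enum 'I_n)).
have -> : iota 1 n = map (fun i : 'I_n => i.+1) (enum 'I_n).
  rewrite -[1]/(1 + 0) iotaDl -val_enum_ord -map_comp.
  by apply: eq_map => i /=; rewrite add1n.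
apply: perm_map; apply: uniq_perm; first by rewrite map_inj_uniq ?enum_uniq //; apply: perm_inj.
  exact: enum_uniq.
move=> i; rewrite mem_enum; apply/mapP; exists (s^-1%g i); first by rewrite mem_enum.
by rewrite permKV.
Qed.

Lemma word_inj n : injective (@word n).
Proof.
move=> s1 s2 /eq_in_map E; apply/permP => i; apply: val_inj.
by have := E i; rewrite mem_enum => /(_ isT) [].
Qed.

(** The one-line words of permutations are distinct rearrangements of 1, ..., n, and
    both sides have n! members. *)
Lemma words_permutations n :
  perm_eq [seq word s | s <- enum {: 'S_n}] (permutations (iota 1 n)).
Proof.
have u1 : uniq [seq word s | s <- enum {: 'S_n}].
  by rewrite map_inj_uniq ?enum_uniq //; apply: word_inj.
have sub : {subset [seq word s | s <- enum {: 'S_n}] <= permutations (iota 1 n)}.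
  by move=> _ /mapP[s _ ->]; rewrite mem_permutations word_perm.
apply: uniq_perm => //; first exact: permutations_uniq.
have [] // := uniq_min_size u1 sub.
by rewrite size_map -cardE size_permutations ?iota_uniq // size_iota card_Sn.
Qed.

Lemma pairwise_enum_ord n (r : rel 'I_n) :
  reflect (forall i j : 'I_n, i < j -> r i j) (pairwise r (enum 'I_n)).
Proof.
apply: (iffP idP) => [/(pairwiseP _) H i j ij|H].
  have := H i i j; rewrite !nth_ord_enum !inE size_enum_ord; exact.
case: n r H => [|n] r H; first by rewrite (size0nil (size_enum_ord 0)).
apply/(pairwiseP ord0) => i j; rewrite !inE size_enum_ord => in0 jn ij.
by apply: H; rewrite !nth_enum_ord.
Qed.

Lemma containsE l n (t : 'S_l) (s : 'S_n) : contains t s = occurs (word t) (word s).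
Proof.
have pw (f : 'I_l -> 'I_n) :
    order_iso (word t) [seq (s (f i)).+1 | i <- enum 'I_l] =
    pairwise (fun i j => (s (f i) < s (f j)) == (t i < t j)) (enum 'I_l).
  by rewrite /order_iso !size_map eqxx /word zip_map pairwise_map.
apply/existsP/occursP => [[f /andP[/forallP fS /forallP fI]]|[z]].
  exists [seq (s (f i)).+1 | i <- enum 'I_l]; last first.
    by rewrite pw; apply/pairwise_enum_ord => i j _; apply: (forallP (fI i)).
  rewrite (map_comp (fun i => (s i).+1) f) map_subseq //.
  have -> : map f (enum 'I_l) = [seq i <- enum 'I_n | i \in map f (enum 'I_l)].
    apply: (@irr_sorted_eq _ (fun i j : 'I_n => i < j)).
    - by move=> ? ? ?; apply: ltn_trans.
    - by move=> ?; rewrite ltnn.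
    - apply: pairwise_sorted; rewrite pairwise_map.
      by apply/pairwise_enum_ord => i j ij; apply: (implyP (forallP (fS i) j)).
    - apply: pairwise_sorted; apply: pairwise_filter.
      exact/pairwise_enum_ord.
    - by move=> i; rewrite mem_filter mem_enum andbT.
  exact: filter_subseq.
move=> /subseqP[m _ ->]; rewrite /word -map_mask; set e := mask m _ => iso.
have se : size e == l.
  by have := order_iso_size iso; rewrite size_map size_enum_ord size_map => ->.
pose f := tnth (Tuple se).
have eE : e = map f (enum 'I_l) by rewrite map_tnth_enum.
have finc (i j : 'I_l) : i < j -> f i < f j.
  move: i j; apply/pairwise_enum_ord; rewrite -(pairwise_map f (fun i j : 'I_n => i < j)) -eE.
  by apply: pairwise_mask; apply/pairwise_enum_ord.
have {}iso : forall i j : 'I_l, i < j -> (s (f i) < s (f j)) == (t i < t j).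
  by apply/pairwise_enum_ord; rewrite -pw; move: iso; rewrite eE -map_comp.
exists (finfun f); apply/andP; split; apply/forallP => i; apply/forallP => j.
  by rewrite !ffunE; apply/implyP/finc.
rewrite !ffunE; have [ij|ji|/val_inj->] := ltngtP i j; first exact: iso.
  have /eqP := iso _ _ ji.
  have ne : val (t j) <> t i by move/val_inj/perm_inj => E; rewrite E ltnn in ji.
  have nf : val (s (f j)) <> s (f i).
    by move/val_inj/perm_inj => E; have := finc _ _ ji; rewrite E ltnn.
  by move: ne nf => /= ; clear; lia.
by rewrite !ltnn.
Qed.

Lemma word132 : word p132 = [:: 1; 3; 2].
Proof.
rewrite /word /p132 !enum_ordSl enum_ord0 /= !permE /=.
by rewrite -!val_eqE /= !inordK.
Qed.

Lemma count_lt_iota j n : j <= n -> count (ltn^~ j) (iota 0 n) = j.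
Proof.
move=> jn; rewrite -(subnKC jn) iotaD count_cat add0n.
rewrite (_ : count _ (iota 0 j) = j); last first.
  apply/eqP; rewrite -[X in _ == X](size_iota 0 j) -all_count.
  by apply/allP => i; rewrite mem_iota.
rewrite (_ : count _ _ = 0) ?addn0 //; apply/eqP; rewrite -leqn0 leqNgt -has_count.
by apply/hasPn => i; rewrite mem_iota /= => /andP[ji _]; rewrite -leqNgt.
Qed.

(** Deleting the first letter of a permutation and standardizing the rest. *)
Lemma lift_permP n (s : 'S_n.+1) : exists s' : 'S_n, s = lift_perm ord0 (s ord0) s'.
Proof.
pose f (k : 'I_n) := odflt k (unlift (s ord0) (s (lift ord0 k))).
have fE k : lift (s ord0) (f k) = s (lift ord0 k).
  rewrite /f; case: unliftP => [j ->|] //= /perm_inj E.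
  by have := neq_lift ord0 k; rewrite E eqxx.
have finj : injective f.
  by move=> i j E; apply: (@lift_inj _ ord0); apply: (@perm_inj _ s); rewrite -!fE E.
exists (perm finj); apply/permP => k; case: (unliftP ord0 k) => [j|] ->.
  by rewrite lift_perm_lift permE fE.
by rewrite lift_perm_id.
Qed.

(** Deleting the first letter j removes j inversions (letters counted from 0), which is
    the parity that [odd_lift_perm] gives to the corresponding lift. *)
Lemma odd_perm_inversions n (s : 'S_n) : odd_perm s = odd (inversions (word s)).
Proof.
have wordE m (p : 'S_m) : word p = map (addn 1) [seq val (p i) | i <- enum 'I_m].
  by rewrite -map_comp; apply: eq_map => i /=; rewrite add1n.
rewrite wordE (inversions_map _ (addn_mono 1)).
elim: n s => [|n IH] s.
  rewrite (size0nil (size_enum_ord 0)) /=.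
  by have -> : s = 1%g; [apply/permP; case | rewrite odd_perm1].
have [s' ->] := lift_permP s; set j := s ord0.
rewrite odd_lift_perm /= IH enum_ordSl /= lift_perm_id -map_comp.
set l := [seq _ | i <- enum 'I_n].
have -> : [seq ((fun i => nat_of_ord (lift_perm ord0 j s' i)) \o lift ord0) i
    | i <- enum 'I_n] = map (bump j) l.
  by rewrite /l -map_comp; apply: eq_map => i /=; rewrite lift_perm_lift.
have bump_mono : {mono bump j : a b / a < b} by move=> a b; rewrite !ltnNge leq_bump2.
rewrite (inversions_map _ bump_mono) oddD count_map.
have pl : perm_eq l (iota 0 n).
  apply: (perm_map_inj (@addnI 1)); rewrite -wordE -iotaDl addn0.
  exact: word_perm.
have -> // : count (preim (bump j) (ltn^~ j)) l = j.
transitivity (count (ltn^~ j) (iota 0 n)); last first.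
  by apply: count_lt_iota; rewrite -ltnS.
rewrite -(seq.permP pl).
apply: eq_count => k; rewrite /= /bump; have [jk|kj] := leqP j k => //.
by rewrite ltnNge leqW.
Qed.

(** * Odd-wedge words *)

(** Odd-wedge patterns in the form suited to induction on the maximal letter; words of
    even length are included because they arise as factors t. The premise that r is an
    odd-wedge word supplies the induction hypothesis for r. *)
Inductive odd_wedge_word : seq nat -> Prop :=
| OddWedgeNil : odd_wedge_word [::]
| OddWedgeCat t l r of
    odd_wedge_word t & odd_wedge_word r &
    all (ltn^~ l) t & all (ltn^~ l) r & allgt t r & sorted ltn r &
    nilp r || ~~ odd (size t + size r) : odd_wedge_word (t ++ l :: r).

Lemma odd_wedge_word_cat t u : odd_wedge_word t -> sorted ltn u ->
  (forall a b, a \in t -> b \in u -> (a < b)%N) -> odd_wedge_word (t ++ u).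
Proof.
move=> tw; elim/last_ind: u => [|u l IH] su tu; first by rewrite cats0.
move: su; rewrite (sorted_pairwise ltn_trans) pairwise_rcons => /andP[ul su].
rewrite -cats1 catA; apply: OddWedgeCat => //.
- apply: IH => [|a b at' bu]; first by rewrite (sorted_pairwise ltn_trans).
  by apply: tu => //; rewrite mem_rcons inE bu orbT.
- exact: OddWedgeNil.
- rewrite all_cat; apply/andP; split => //; apply/allP => a at'.
  by apply: tu => //; rewrite mem_rcons mem_head.
- by apply/allgtP.
Qed.

Lemma sorted_odd_wedge_word u : sorted ltn u -> odd_wedge_word u.
Proof. by move=> su; rewrite -[u]cat0s; apply: odd_wedge_word_cat => //; apply: OddWedgeNil. Qed.

Lemma concat_blocks_rcons d b :
  concat_blocks (rcons d b) = concat_blocks d ++ b.1 ++ b.2.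
Proof. by rewrite /concat_blocks map_rcons flatten_rcons. Qed.

Lemma mem_concat_blocks d a : (a \in concat_blocks d) =
  (a \in flatten (unzip1 d)) || (a \in flatten (unzip2 d)).
Proof.
elim: d => [|b d IH] //=; rewrite /concat_blocks /= !mem_cat -/(concat_blocks d) IH.
by do !case: (a \in _).
Qed.

(** In the last block (u, v) the final letter of u is the maximum. Removing it and v
    leaves the earlier blocks followed by an increasing run of larger letters, which
    can be added one letter at a time with r empty; the parity condition is needed
    for the final letter only, and holds since the whole length is odd. *)
Lemma odd_wedge_concat_blocks d :
    sorted ltn (flatten (unzip1 d)) ->
    (forall a c, a \in flatten (unzip2 d) -> c \in flatten (unzip1 d) -> (a < c)%N) ->
    all (sorted ltn) (unzip2 d) -> pairwise allgt (unzip2 d) ->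
    all (fun b => b.1 != [::]) d ->
    (forall p, (1 <= p <= size d)%N -> odd (size (concat_blocks (take p d)))) ->
  odd_wedge_word (concat_blocks d).
Proof.
elim/last_ind: d => [|d [u v] IH]; first by move=> *; apply: OddWedgeNil.
rewrite concat_blocks_rcons /unzip1 /unzip2 !map_rcons !flatten_rcons /=.
rewrite -!/(unzip1 d) -!/(unzip2 d) !all_rcons pairwise_rcons size_rcons /=.
rewrite (sorted_pairwise ltn_trans) pairwise_cat -!(sorted_pairwise ltn_trans).
move=> /and3P[/allrelP d1u s1 su] below /andP[sv s2] /andP[d2v p2] /andP[u0 d0] oddd.
have {IH} tw : odd_wedge_word (concat_blocks d).
  apply: IH => // [a c a2 c1|p /andP[p0 pd]].
    by apply: below; rewrite mem_cat ?a2 ?c1.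
  by have := oddd p; rewrite p0 (leqW pd) -cats1 takel_cat // => /(_ isT).
have := oddd (size d).+1; rewrite /= leqnn -(size_rcons d (u, v)) take_size => /(_ isT).
rewrite concat_blocks_rcons /=.
have uv a c : a \in v -> c \in u -> (a < c)%N.
  by move=> av cu; apply: below; rewrite mem_cat ?av ?cu orbT.
have du a c : a \in concat_blocks d -> c \in u -> (a < c)%N.
  rewrite mem_concat_blocks => /orP[a1|a2] cu; first exact: d1u.
  by apply: below; rewrite mem_cat ?a2 // cu orbT.
have dv a c : a \in concat_blocks d -> c \in v -> (c < a)%N.
  rewrite mem_concat_blocks => /orP[a1|/flattenP[r rd ar]] cv.
    by apply: below; rewrite mem_cat ?a1 ?cv ?orbT.
  by have /allgtP := allP d2v _ rd; apply.
case/lastP: u u0 su uv du {d1u below oddd} => // u l _ su uv du.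
move: (su); rewrite (sorted_pairwise ltn_trans) pairwise_rcons => /andP[ul su'].
rewrite -cats1 -catA /= => odds.
rewrite catA; apply: OddWedgeCat => //.
- apply: odd_wedge_word_cat => // [|a b ad bu]; first by rewrite (sorted_pairwise ltn_trans).
  by apply: du => //; rewrite mem_rcons inE bu orbT.
- exact: sorted_odd_wedge_word.
- rewrite all_cat ul andbT; apply/allP => a ad.
  by apply: du => //; rewrite mem_rcons mem_head.
- by apply/allP => a av; apply: uv => //; rewrite mem_rcons mem_head.
- apply/allgtP => a c; rewrite mem_cat => /orP[ad|au] cv; first exact: dv.
  by apply: uv => //; rewrite mem_rcons inE au orbT.
- apply/orP; right; move: odds; rewrite !size_cat /= !addnS /= addnA => /negbTE.
  by rewrite /= => ->.
Qed.

Lemma odd_wedge_pattern_word l (t : 'S_l) :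
  odd_wedge_pattern t -> odd_wedge_word (word t).
Proof.
move=> [d [[-> d0 [s [sl f1 f2 s2 p2]]] oddd]].
apply: odd_wedge_concat_blocks => //; first by rewrite f1 iota_ltn_sorted.
move=> a c; rewrite f1 (perm_mem f2) !mem_iota => /andP[_ a_s] /andP[sc _].
by apply: leq_trans sc; rewrite -add1n.
Qed.

Local Open Scope ring_scope.

(** * Formal power series *)

Record series (R : comNzRingType) := Series { scoef : nat -> R }.

Section SeriesRing.
Variable R : comNzRingType.
Implicit Types a b c : series R.

HB.instance Definition _ := gen_eqMixin (series R).
HB.instance Definition _ := gen_choiceMixin (series R).

Lemma seriesP a b : (forall n, scoef a n = scoef b n) -> a = b.
Proof. by case: a b => [a] [b] /= /funext ->. Qed.

Definition szero : series R := Series (fun=> 0).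
Definition sone : series R := Series (fun n => (n == 0%N)%:R).
Definition sopp a := Series (fun n => - scoef a n).
Definition sadd a b := Series (fun n => scoef a n + scoef b n).
Definition smul a b :=
  Series (fun n => \sum_(i < n.+1) scoef a i * scoef b (n - i)).

(** The ring laws of series are inherited from polynomials: a coefficient of a product
    depends on finitely many coefficients of the factors. *)
Definition truncation n a : {poly R} := \poly_(i < n.+1) scoef a i.

Lemma coef_truncation n a i : (i <= n)%N -> (truncation n a)`_i = scoef a i.
Proof. by move=> lin; rewrite coef_poly ltnS lin. Qed.

Lemma scoef_smul n a b i : (i <= n)%N ->
  scoef (smul a b) i = (truncation n a * truncation n b)`_i.
Proof.
move=> lin; rewrite coefM; apply: eq_bigr => j _.
by rewrite !coef_truncation // ?(leq_trans (leq_subr _ _)) // (leq_trans _ lin) // -ltnS.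
Qed.

Fact saddA : associative sadd.
Proof. by move=> a b c; apply: seriesP => n /=; rewrite addrA. Qed.
Fact saddC : commutative sadd.
Proof. by move=> a b; apply: seriesP => n /=; rewrite addrC. Qed.
Fact sadd0 : left_id szero sadd.
Proof. by move=> a; apply: seriesP => n /=; rewrite add0r. Qed.
Fact saddN : left_inverse szero sopp sadd.
Proof. by move=> a; apply: seriesP => n /=; rewrite addNr. Qed.

HB.instance Definition _ := GRing.isZmodule.Build (series R) saddA saddC sadd0 saddN.

Fact smulC : commutative smul.
Proof.
by move=> a b; apply: seriesP => n; rewrite !(@scoef_smul n) // mulrC.
Qed.
Fact smulA : associative smul.
Proof.
move=> a b c; apply: seriesP => n.
transitivity ((truncation n a * truncation n b * truncation n c)`_n).
  rewrite -mulrA coefM; apply: eq_bigr => i _.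
  by rewrite coef_truncation ?(@scoef_smul n) ?leq_subr // -ltnS.
rewrite coefM; apply: eq_bigr => i _.
by rewrite coef_truncation ?(@scoef_smul n) ?leq_subr // -ltnS.
Qed.
Fact smul1 : left_id sone smul.
Proof.
move=> a; apply: seriesP => n /=.
by rewrite big_ord_recl /= mul1r subn0 big1 ?addr0 // => i _; rewrite mul0r.
Qed.
Fact smulDl : left_distributive smul sadd.
Proof.
move=> a b c; apply: seriesP => n /=; rewrite -big_split /=.
by apply: eq_bigr => i _; rewrite mulrDl.
Qed.
Fact sone_neq0 : sone != 0.
Proof.
by apply/eqP => /(congr1 (fun a => scoef a 0)) /eqP /=; rewrite oner_eq0.
Qed.

HB.instance Definition _ :=
  GRing.Zmodule_isComNzRing.Build (series R) smulA smulC smul1 smulDl sone_neq0.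

Lemma scoefD a b n : scoef (a + b) n = scoef a n + scoef b n. Proof. by []. Qed.
Lemma scoefB a b n : scoef (a - b) n = scoef a n - scoef b n. Proof. by []. Qed.
Lemma scoefM a b n :
  scoef (a * b) n = \sum_(i < n.+1) scoef a i * scoef b (n - i).
Proof. by []. Qed.
Lemma scoef1 n : scoef (1 : series R) n = (n == 0%N)%:R. Proof. by []. Qed.
Lemma scoefN a n : scoef (- a) n = - scoef a n. Proof. by []. Qed.
Lemma scoefM0 a b : scoef (a * b) 0 = scoef a 0 * scoef b 0.
Proof. by rewrite scoefM big_ord1. Qed.

Definition pser (p : {poly R}) : series R := Series (nth 0 p).

Fact pser_is_zmod : zmod_morphism pser.
Proof. by move=> p q; apply: seriesP => n; rewrite scoefB /= coefB. Qed.
Fact pser_is_monoid : monoid_morphism pser.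
Proof.
split=> [|p q]; apply: seriesP => n; first by rewrite scoef1 /= coef1.
by rewrite scoefM /= coefM.
Qed.
HB.instance Definition _ :=
  GRing.isZmodMorphism.Build {poly R} (series R) pser pser_is_zmod.
HB.instance Definition _ :=
  GRing.isMonoidMorphism.Build {poly R} (series R) pser pser_is_monoid.

Lemma scoefXM0 a : scoef (pser 'X * a) 0 = 0.
Proof. by rewrite scoefM big_ord1 /= coefX mul0r. Qed.
Lemma scoefXMS a n : scoef (pser 'X * a) n.+1 = scoef a n.
Proof.
rewrite scoefM big_ord_recl /= coefX mul0r add0r big_ord_recl /= coefX mul1r subn1.
by rewrite big1 ?addr0 // => i _; rewrite coefX mul0r.
Qed.

Lemma scoefCM (c : R) a n : scoef (pser c%:P * a) n = c * scoef a n.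
Proof.
rewrite scoefM big_ord_recl /= coefC eqxx subn0 big1 ?addr0 // => i _.
by rewrite coefC mul0r.
Qed.
End SeriesRing.

(** * Series expansions of rational functions *)

Section Expands.
Local Notation ser := (series rat).
Local Notation X := (pser ('X : {poly rat})).

Fact poly_at_x_is_zmod : zmod_morphism poly_at_x.
Proof. by move=> p q; rewrite /poly_at_x comp_polyB rmorphB. Qed.
Fact poly_at_x_is_monoid : monoid_morphism poly_at_x.
Proof.
by split=> [|p q]; rewrite /poly_at_x ?comp_polyM ?rmorphM //= comp_polyC rmorph1.
Qed.
HB.instance Definition _ :=
  GRing.isZmodMorphism.Build {poly rat} Qsqrtx poly_at_x poly_at_x_is_zmod.
HB.instance Definition _ :=
  GRing.isMonoidMorphism.Build {poly rat} Qsqrtx poly_at_x poly_at_x_is_monoid.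

Lemma poly_at_x_eq0 p : (poly_at_x p == 0) = (p == 0).
Proof.
rewrite /poly_at_x tofrac_eq0; apply/eqP/eqP => [p0|->]; last exact: comp_poly0.
apply/polyP => i; have /polyP/(_ (i * 2)%N) := p0.
by rewrite coef_comp_poly_Xn // dvdn_mull // mulnK // !coef0.
Qed.

Lemma poly_at_xX : poly_at_x 'X = varx.
Proof. by rewrite /poly_at_x comp_polyX /varx /sqrtx rmorphXn. Qed.

(** [series_eq] read as a relation compatible with the ring structure of series. *)
Definition expands (a : ser) (f : Qsqrtx) : Prop := series_eq (scoef a) f.

Lemma expandsP a f : expands a f <-> exists p q : {poly rat},
  [/\ q != 0, f = poly_at_x p / poly_at_x q & pser q * a = pser p].
Proof.
split=> -[p [q [q0 fE qa]]]; exists p, q; split=> //.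
  by apply: seriesP => n; rewrite scoefM /= qa.
by move=> n; move: (congr1 (fun a => scoef a n) qa); rewrite scoefM.
Qed.

Lemma expands_pser p : expands (pser p) (poly_at_x p).
Proof.
by apply/expandsP; exists p, 1; rewrite oner_neq0 !rmorph1 divr1 mul1r.
Qed.

Lemma expandsX : expands X varx.
Proof. by rewrite -poly_at_xX; apply: expands_pser. Qed.
Lemma expands1 : expands 1 1.
Proof. by have := expands_pser 1; rewrite !rmorph1. Qed.
Lemma expands0 : expands 0 0.
Proof. by have := expands_pser 0; rewrite !rmorph0. Qed.

Lemma expandsM a b f g : expands a f -> expands b g -> expands (a * b) (f * g).
Proof.
move=> /expandsP[p [q [q0 -> qa]]] /expandsP[r [s [s0 -> sb]]].
apply/expandsP; exists (p * r), (q * s); rewrite mulf_neq0 // !rmorphM; split=> //.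
  by rewrite -mulf_div.
by rewrite mulrACA qa sb.
Qed.

Lemma expandsD a b f g : expands a f -> expands b g -> expands (a + b) (f + g).
Proof.
move=> /expandsP[p [q [q0 -> qa]]] /expandsP[r [s [s0 -> sb]]].
apply/expandsP; exists (p * s + r * q), (q * s); rewrite mulf_neq0 //; split=> //.
  by rewrite rmorphD !rmorphM addf_div ?poly_at_x_eq0.
by rewrite rmorphD !rmorphM /= -qa -sb; ring.
Qed.

Lemma expandsN a f : expands a f -> expands (- a) (- f).
Proof.
move=> /expandsP[p [q [q0 -> qa]]].
apply/expandsP; exists (- p), q; split=> //; first by rewrite rmorphN mulNr.
by rewrite mulrN qa rmorphN.
Qed.

Lemma expandsB a b f g : expands a f -> expands b g -> expands (a - b) (f - g).
Proof. by move=> ea eb; apply: expandsD => //; apply: expandsN. Qed.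

(** If f = 0 then q a = 0 for some polynomial q != 0; but the lowest coefficient of
    q a is the product of those of q and a. *)
Lemma expands_neq0 a f : expands a f -> scoef a 0 != 0 -> f != 0.
Proof.
move=> /expandsP[p [q [q0 -> qa]]] a0.
rewrite mulf_neq0 ?invr_eq0 ?poly_at_x_eq0 //; apply: contraNneq a0 => p0.
move: qa; rewrite p0 rmorph0 => qa.
have exq : exists i, q`_i != 0 by exists (size q).-1; rewrite -lead_coefE lead_coef_eq0.
have := congr1 (fun b => scoef b (ex_minn exq)) qa.
case: ex_minnP => m qm mmin /=; rewrite big_ord_recr /= subnn big1 ?add0r => [/eqP|i _].
  by rewrite mulf_eq0 (negPf qm).
have [->|/mmin] := eqVneq q`_i 0; first by rewrite mul0r.
by rewrite leqNgt ltn_ord.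
Qed.

(** Division without inverting series: a is the solution of b a = c. *)
Lemma expands_div a b c f g : expands b f -> scoef b 0 != 0 -> expands c g ->
  b * a = c -> expands a (g / f).
Proof.
move=> eb b0 ec ba; have f0 := expands_neq0 eb b0.
move: eb ec f0 => /expandsP[p [q [q0 -> qb]]] /expandsP[r [s [s0 -> sc]]] f0.
have p0 : p != 0 by apply: contraNneq f0 => ->; rewrite rmorph0 mul0r.
apply/expandsP; exists (r * q), (s * p); rewrite mulf_neq0 // !rmorphM; split=> //.
  by rewrite invf_div mulf_div.
by rewrite /= -qb -sc -ba; ring.
Qed.
End Expands.

(** * Counting recurrences *)

Section CountingRecurrence.
Variable signed : bool.

(** The plain and the signed count obey the same recurrence up to signs; the boolean
    [signed], read as an exponent 0 or 1 of the sign, treats them together. *)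
Definition weight (t w : seq nat) : rat :=
  (~~ occurs t w)%:R * (-1) ^+ (signed * inversions w).

Definition weighted_count (t : seq nat) (n : nat) : rat := \sum_(w <- av132 n) weight t w.

Lemma weighted_count_nil n : weighted_count [::] n = 0.
Proof. by apply: big1 => w _; rewrite /weight occurs_nil mul0r. Qed.

Lemma av132_0 : av132 0 = [:: [::]].
Proof. by rewrite /av132 /= occurs_small. Qed.

Lemma weighted_count_0 t : (0 < size t)%N -> weighted_count t 0 = 1.
Proof.
move=> t0; rewrite /weighted_count av132_0 big_seq1 /weight occurs_small //.
by rewrite muln0 mulr1.
Qed.

Variables (t r : seq nat) (l : nat).
Hypotheses (tl : all (ltn^~ l) t) (rl : all (ltn^~ l) r).
Hypotheses (tr : allgt t r) (sr : sorted ltn r).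
Local Notation tau := (t ++ l :: r).

(** The word glue u v avoids t l r when v avoids t l r and u avoids t, or when v
    avoids r and u avoids t l r but contains t; the two cases are the two products. *)
Lemma weight_glue a b u v : u \in av132 a -> v \in av132 b ->
  weight tau (glue u v) = (-1) ^+ (signed * (a.+1 * b)) *
    (weight t u * weight tau v + (weight tau u - weight t u) * weight r v).
Proof.
move=> ua vb; rewrite /weight (inversions_glue ua vb) !mulnDr !exprD.
rewrite /glue occurs_peak ?(glue_lt_left v ua) ?(glue_lt_right u vb) ?(glue_allgt ua vb) //.
rewrite !(occurs_map _ _ (addn_mono _)).
have tau_t : occurs tau u -> occurs t u by apply: occurs_catl.
have tau_r : occurs tau v -> occurs r v.
  by rewrite -cat_rcons; apply: occurs_catr.
move: tau_t tau_r; case: (occurs t u); case: (occurs r v);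
  case: (occurs tau u) => tau_t; case: (occurs tau v) => tau_r;
  try (by have := tau_t isT); try (by have := tau_r isT); rewrite /=; ring.
Qed.

Lemma weighted_count_S n : weighted_count tau n.+1 =
  \sum_(a < n.+1) (-1) ^+ (signed * (a.+1 * (n - a))) *
    (weighted_count t a * weighted_count tau (n - a) +
     (weighted_count tau a - weighted_count t a) * weighted_count r (n - a)).
Proof.
rewrite /weighted_count (perm_big _ (av132S n)) big_allpairs_dep.
rewrite -[iota 0 n.+1]/(index_iota 0 n.+1) big_mkord; apply: eq_bigr => a _.
rewrite big_allpairs /=.
have E u : u \in av132 a -> \sum_(v <- av132 (n - a)) weight tau (glue u v) =
  (-1) ^+ (signed * (a.+1 * (n - a))) * (weight t u * weighted_count tau (n - a) +
    (weight tau u - weight t u) * weighted_count r (n - a)).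
  move=> ua; rewrite /weighted_count !big_distrr /= -big_split /= big_distrr.
  by apply: eq_big_seq => v vb; rewrite (weight_glue ua vb).
rewrite (eq_big_seq _ E) -big_distrr /=; congr (_ * _).
by rewrite big_split -!big_distrl /= sumrB.
Qed.
End CountingRecurrence.

Local Notation X := (pser ('X : {poly rat})).

Definition total_series t : series rat := Series (weighted_count false t).
Definition even_part (a : nat -> rat) : series rat :=
  Series (fun n => if odd n then 0 else a n).
Definition odd_part (a : nat -> rat) : series rat :=
  Series (fun n => if odd n then a n else 0).
Definition even_series t := even_part (weighted_count true t).
Definition odd_series t := odd_part (weighted_count true t).

Section SeriesRecurrence.
Variables (t r : seq nat) (l : nat).
Hypotheses (tl : all (ltn^~ l) t) (rl : all (ltn^~ l) r).
Hypotheses (tr : allgt t r) (sr : sorted ltn r).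
Local Notation tau := (t ++ l :: r).

Let tau_gt0 : (0 < size tau)%N. Proof. by rewrite size_cat addnS. Qed.

Lemma total_series_rec : total_series tau = 1 + X *
  (total_series t * total_series tau +
   (total_series tau - total_series t) * total_series r).
Proof.
apply: seriesP => -[|n]; first by rewrite scoefD scoefXM0 addr0 /= weighted_count_0.
rewrite scoefD scoef1 add0r scoefXMS scoefD !scoefM -big_split.
by rewrite /= weighted_count_S //; apply: eq_bigr => a _; rewrite mul0n mul1r.
Qed.

(** A term (a, b) of the signed recurrence has sign (-1)^((a + 1) b), which is -1 for a
    even and b odd only; in degree a + b + 1, that case contributes to E alone. *)
Lemma even_series_rec : even_series tau = 1 + X *
  (odd_series t * even_series tau - even_series t * odd_series tau +
   (odd_series tau - odd_series t) * even_series r -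
   (even_series tau - even_series t) * odd_series r).
Proof.
apply: seriesP => -[|n]; first by rewrite scoefD scoefXM0 addr0 /= weighted_count_0.
rewrite scoefD scoef1 add0r scoefXMS !(scoefB, scoefD) !scoefM.
rewrite -sumrB -big_split -sumrB /=.
have parity (a : 'I_n.+1) : odd (n - a) = odd n (+) odd a.
  by rewrite oddB // -ltnS.
case: ifP => /= oddn.
  symmetry; apply: big1 => a _; rewrite parity.
  by move: oddn; case: (odd n) => // _; case: (odd a); rewrite /=; ring.
rewrite weighted_count_S //; apply: eq_bigr => a _.
rewrite mul1n -signr_odd oddM /= parity.
by move: oddn; case: (odd n) => // _; case: (odd a); rewrite /=; ring.
Qed.

Lemma odd_series_rec : odd_series tau = X *
  (odd_series t * odd_series tau + even_series t * even_series tau +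
   (odd_series tau - odd_series t) * odd_series r +
   (even_series tau - even_series t) * even_series r).
Proof.
apply: seriesP => -[|n]; first by rewrite scoefXM0.
rewrite scoefXMS !(scoefB, scoefD) !scoefM -!big_split /=.
have parity (a : 'I_n.+1) : odd (n - a) = odd n (+) odd a.
  by rewrite oddB // -ltnS.
case: ifP => /= oddn; last first.
  symmetry; apply: big1 => a _; rewrite parity.
  by move: oddn; case: (odd n) => // _; case: (odd a); rewrite /=; ring.
rewrite weighted_count_S //; apply: eq_bigr => a _.
rewrite mul1n -signr_odd oddM /= parity.
by move: oddn; case: (odd n) => // _; case: (odd a); rewrite /=; ring.
Qed.
End SeriesRecurrence.

(** * Solving the signed recurrence *)

Section Cramer.
Variables (R : comNzRingType) (x e o em om E O : R).

(** With t and r known, the signed recurrence is a linear system in E and O; these are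
    its determinant and the two numerators of its solution by Cramer's rule. *)
Definition cramer_det :=
  (1 - x * o + x * om) * (1 - x * o - x * om) + x * (e - em) * (x * (e + em)).
Definition cramer_even :=
  (1 - x * o * em + x * e * om) * (1 - x * o - x * om) +
  x * (e - em) * (x * (o * om + e * em)).
Definition cramer_odd :=
  x * (e + em) * (1 - x * o * em + x * e * om) -
  (1 - x * o + x * om) * (x * (o * om + e * em)).

Definition even_eq := E = 1 + x * (o * E - e * O + (O - o) * em - (E - e) * om).
Definition odd_eq := O = x * (o * O + e * E + (O - o) * om + (E - e) * em).

Lemma cramerP : even_eq -> odd_eq ->
  cramer_det * E = cramer_even /\ cramer_det * O = cramer_odd.
Proof.
rewrite /even_eq /odd_eq => E1 E2.
have L1 : (1 - x * o + x * om) * E + x * (e - em) * O = 1 - x * o * em + x * e * om.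
  by move/eqP: E1; rewrite -subr_eq0 => /eqP E1; rewrite -[RHS]addr0 -E1; ring.
have L2 : (1 - x * o - x * om) * O - x * (e + em) * E = - (x * (o * om + e * em)).
  by move/eqP: E2; rewrite -subr_eq0 => /eqP E2; rewrite -[RHS]addr0 -E2; ring.
split.
  transitivity ((1 - x * o - x * om) * ((1 - x * o + x * om) * E + x * (e - em) * O)
    - x * (e - em) * ((1 - x * o - x * om) * O - x * (e + em) * E)).
    by rewrite /cramer_det; ring.
  by rewrite L1 L2 /cramer_even; ring.
transitivity ((1 - x * o + x * om) * ((1 - x * o - x * om) * O - x * (e + em) * E)
    + x * (e + em) * ((1 - x * o + x * om) * E + x * (e - em) * O)).
  by rewrite /cramer_det; ring.
by rewrite L1 L2 /cramer_odd; ring.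
Qed.
End Cramer.

Ltac expands_ring := repeat first
  [ assumption | apply: expands1 | apply: expandsX
  | apply: expandsB | apply: expandsD | apply: expandsM ].

(** The signed system has a unique solution both among series and among rational
    functions, because its determinant has constant term 1. So a rational solution
    found by any means is the sum of the series. *)
Lemma expands_cramer (e o em om E O : series rat) (fe fo fem fom fE fO : Qsqrtx) :
    expands e fe -> expands o fo -> expands em fem -> expands om fom ->
    even_eq X e o em om E O -> odd_eq X e o em om E O ->
    even_eq varx fe fo fem fom fE fO -> odd_eq varx fe fo fem fom fE fO ->
  expands E fE /\ expands O fO.
Proof.
move=> he ho hem hom s1 s2 f1 f2.
have [sE sO] := cramerP s1 s2; have [ffE ffO] := cramerP f1 f2.
have hd : expands (cramer_det X e o em om) (cramer_det varx fe fo fem fom).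
  by rewrite /cramer_det; expands_ring.
have d0 : scoef (cramer_det X e o em om) 0 != 0.
  rewrite /cramer_det !(scoefD, scoefN, scoefXM0, scoefM0, scoef1) eqxx.
  by rewrite !(oppr0, mul0r, addr0) mulr1 oner_neq0.
have fd0 := expands_neq0 hd d0.
have -> : fE = cramer_even varx fe fo fem fom / cramer_det varx fe fo fem fom.
  by rewrite -ffE mulrC mulKf.
have -> : fO = cramer_odd varx fe fo fem fom / cramer_det varx fe fo fem fom.
  by rewrite -ffO mulrC mulKf.
split; [apply: (expands_div hd d0 _ sE) | apply: (expands_div hd d0 _ sO)].
  by rewrite /cramer_even; expands_ring.
by rewrite /cramer_odd; expands_ring.
Qed.

(** * Ratios of Chebyshev polynomials *)

Section RatioRecurrence.
Variables (F : fieldType) (y : F) (r : nat -> F).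
Hypotheses (r0 : r 0 = 0) (rS : forall k, r k.+1 * (1 - y * r k) = 1).

(** Induction on b, moving one unit from b to a: clearing denominators turns the
    equation for (a, b + 1) into the one for (a + 1, b). *)
Lemma ratio_addS a b :
  r (a + b).+1 * (1 - y * r a - y * r b) = 1 - y * r a * r b.
Proof.
elim: b a => [|b IHb] a; first by rewrite addn0 r0 !mulr0 !subr0 rS.
have nz k : 1 - y * r k != 0.
  by apply/eqP => z; move: (rS k); rewrite z mulr0 => /eqP; rewrite eq_sym oner_eq0.
have rE k : r k.+1 = (1 - y * r k)^-1 by rewrite -[LHS](mulfK (nz k)) rS mul1r.
have := IHb a.+1; rewrite addSnnS !rE => IH.
apply: (mulIf (nz b)); move: IH => /(congr1 ( *%R^~ (1 - y * r a))).
have := nz a; have := nz b => nzb nza.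
set R := (1 - y * r (a + b.+1))^-1.
have -> : R * (1 - y * (1 - y * r a)^-1 - y * r b) * (1 - y * r a)
  = R * ((1 - y * r a) * (1 - y * r b) - y) by field.
have -> : (1 - y * (1 - y * r a)^-1 * r b) * (1 - y * r a)
  = 1 - y * r a - y * r b by field.
have -> : R * (1 - y * r a - y * (1 - y * r b)^-1) * (1 - y * r b)
  = R * ((1 - y * r a) * (1 - y * r b) - y) by field.
by move=> ->; field.
Qed.

Lemma ratio_add a b : r (a + b) * (1 - y * r a * r b) = r a + r b - r a * r b.
Proof.
case: a => [|a]; first by rewrite r0 mulr0 !mul0r !subr0 mulr1 add0r.
have /(congr1 ( *%R (r a.+1))) := ratio_addS a b; rewrite addSn.
have rya : y * (r a.+1 * r a) = r a.+1 - 1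
  by transitivity (r a.+1 - r a.+1 * (1 - y * r a)); [ring | rewrite rS].
set R := r (a + b).+1.
have -> : r a.+1 * (R * (1 - y * r a - y * r b))
  = R * (r a.+1 - y * (r a.+1 * r a) - y * r a.+1 * r b) by ring.
have -> : r a.+1 * (1 - y * r a * r b) = r a.+1 - y * (r a.+1 * r a) * r b by ring.
rewrite rya => H; transitivity (R * (r a.+1 - (r a.+1 - 1) - y * r a.+1 * r b)).
  by ring.
by rewrite H; ring.
Qed.
End RatioRecurrence.

Section ReversedChebyshev.
Variables (F : fieldType) (s : F).
Hypotheses (two_neq0 : (2 : F) != 0) (s_neq0 : s != 0).

(** [revU y k] is s^k U_k(1 / (2 s)) for y = s^2, a polynomial in y with constant
    term 1. *)
Fixpoint revU (R : comNzRingType) (y : R) (k : nat) : R :=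
  match k with
  | 0 => 1
  | k1.+1 => match k1 with
             | 0 => 1
             | k2.+1 => revU y k1 - y * revU y k2
             end
  end.

Lemma chebU_revU k : chebU k (2 * s)^-1 = revU (s ^+ 2) k / s ^+ k.
Proof.
have half : 2 * (2 * s)^-1 = s^-1 by field; rewrite two_neq0 s_neq0.
suff: chebU k (2 * s)^-1 = revU (s ^+ 2) k / s ^+ k /\
      chebU k.+1 (2 * s)^-1 = revU (s ^+ 2) k.+1 / s ^+ k.+1 by case.
elim: k => [|k [IH1 IH2]].
  by rewrite /= expr0 divr1 expr1 mul1r half.
split=> //=; rewrite -/(chebU k.+1 _) -/(revU _ k.+1) half IH1 IH2 !exprS expr0.
by field; rewrite expf_neq0.
Qed.

Hypothesis revU_neq0 : forall k, revU (s ^+ 2) k != 0.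
Let ratio k := if k is k1.+1 then
  chebU k1 (2 * s)^-1 / (s * chebU k (2 * s)^-1) else 0.

Lemma ratioE k : ratio k =
  (if k is k1.+1 then revU (s ^+ 2) k1 else 0) / revU (s ^+ 2) k.
Proof.
case: k => [|k]; first by rewrite mul0r.
rewrite /ratio !chebU_revU (exprS s k).
by field; rewrite !revU_neq0 s_neq0 expf_neq0.
Qed.

Lemma ratioS k : ratio k.+1 * (1 - s ^+ 2 * ratio k) = 1.
Proof.
rewrite !ratioE; set w : F := if k is k1.+1 then _ else _.
have E : revU (s ^+ 2) k.+1 = revU (s ^+ 2) k - s ^+ 2 * w.
  by rewrite /w; case: (k) => [|k'] //; rewrite mulr0 subr0.
have := revU_neq0 k; have := revU_neq0 k.+1; rewrite E.
by move: (revU _ k) => U U1 U0; field; rewrite U0 U1.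
Qed.
End ReversedChebyshev.

(** Both x = (sqrt x)^2 and x^2 occur as arguments of R, whence the parameter sigma:
    the square root of the argument, as a polynomial in sqrt x vanishing at 0. *)
Section ChebyshevRatio.
Variable sigma : {poly rat}.
Hypotheses (sigma0 : sigma`_0 = 0) (sigma_neq0 : sigma != 0).
Local Notation s := (tofrac sigma : Qsqrtx).

Lemma tofrac_neq0 (p : {poly rat}) : p`_0 != 0 -> (tofrac p : Qsqrtx) != 0.
Proof. by apply: contraNneq => /eqP; rewrite tofrac_eq0 => /eqP ->; rewrite coef0. Qed.

Lemma coef0_revU k : (revU (sigma ^+ 2) k)`_0 = 1.
Proof.
suff: (revU (sigma ^+ 2) k)`_0 = 1 /\ (revU (sigma ^+ 2) k.+1)`_0 = 1 by case.
elim: k => [|k [IH1 IH2]]; first by rewrite coef1.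
split=> //=; rewrite -/(revU _ k.+1) coefB IH2 -mulrA coefM big_ord1 /= sigma0.
by rewrite mul0r subr0.
Qed.

Lemma tofrac_revU k : tofrac (revU (sigma ^+ 2) k) = revU (s ^+ 2) k.
Proof.
suff: tofrac (revU (sigma ^+ 2) k) = revU (s ^+ 2) k /\
  tofrac (revU (sigma ^+ 2) k.+1) = revU (s ^+ 2) k.+1 by case.
elim: k => [|k [IH1 IH2]]; first by rewrite rmorph1.
by split=> //=; rewrite -/(revU _ k.+1) rmorphB rmorphM rmorphXn /= IH1 IH2.
Qed.

Lemma revU_neq0 k : revU (s ^+ 2) k != 0.
Proof. by rewrite -tofrac_revU tofrac_neq0 // coef0_revU oner_neq0. Qed.

Lemma Qsqrtx_two_neq0 : (2 : Qsqrtx) != 0.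
Proof.
have -> : 2 = tofrac 2%:R :> Qsqrtx by rewrite rmorph_nat.
by apply: tofrac_neq0; rewrite -polyC_natr coefC.
Qed.

Lemma RchebS k : Rcheb k.+1 s * (1 - s ^+ 2 * Rcheb k s) = 1.
Proof.
by apply: ratioS; [exact: Qsqrtx_two_neq0 | rewrite tofrac_eq0 | exact: revU_neq0].
Qed.

Lemma Rcheb_sq_neq0 k : 1 + s ^+ 2 * Rcheb k s ^+ 2 != 0.
Proof.
case: k => [|k]; first by rewrite /Rcheb expr0n mulr0 addr0 oner_neq0.
have -> : Rcheb k.+1 s = revU (s ^+ 2) k / revU (s ^+ 2) k.+1.
  apply: (ratioE _ _ _ k.+1); first exact: Qsqrtx_two_neq0.
    by rewrite tofrac_eq0.
  exact: revU_neq0.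
have nz := revU_neq0 k.+1.
have: revU (s ^+ 2) k.+1 ^+ 2 + s ^+ 2 * revU (s ^+ 2) k ^+ 2 != 0.
  rewrite -!tofrac_revU -!rmorphXn -rmorphM -rmorphD tofrac_neq0 //.
  have := coef0_revU k; have := coef0_revU k.+1.
  move: (revU _ k) (revU _ k.+1) => U V cV cU.
  by rewrite coefD !expr2 !coef0M sigma0 cV !mul0r addr0 mulr1 oner_neq0.
have clear_denom (F : fieldType) (y u v : F) : v != 0 ->
    v ^+ 2 + y * u ^+ 2 = (1 + y * (u / v) ^+ 2) * v ^+ 2 by move=> v0; field.
by rewrite (clear_denom _ _ _ _ nz); apply: contraNneq => ->; rewrite mul0r.
Qed.
End ChebyshevRatio.

Lemma RchebS_sqrtx k : Rcheb k.+1 sqrtx * (1 - varx * Rcheb k sqrtx) = 1.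
Proof. by apply: RchebS; rewrite ?polyX_eq0 // coefX. Qed.

Lemma varxE : varx = tofrac 'X^2. Proof. by rewrite rmorphXn. Qed.
Lemma RchebS_varx k : Rcheb k.+1 varx * (1 - varx ^+ 2 * Rcheb k varx) = 1.
Proof. by rewrite varxE; apply: RchebS; rewrite ?monic_neq0 ?monicXn // coefXn. Qed.
Lemma Rcheb_sq_varx_neq0 k : 1 + varx ^+ 2 * Rcheb k varx ^+ 2 != 0.
Proof. by rewrite varxE; apply: Rcheb_sq_neq0; rewrite ?monic_neq0 ?monicXn // coefXn. Qed.

(** * Closed forms and the theorem *)

Section Solution.
Variables (F : fieldType) (x : F) (r : nat -> F).
Hypotheses (r0 : r 0 = 0) (rS : forall k, r k.+1 * (1 - x ^+ 2 * r k) = 1).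
Hypothesis r_sq : forall k, 1 + x ^+ 2 * r k ^+ 2 != 0.

(** The sums of the even-degree and odd-degree signed series for patterns of length n,
    where r k stands for R_k(x^2). *)
Definition even_value n :=
  if odd n then 1 else r n./2 / (1 + x ^+ 2 * r n./2 ^+ 2).
Definition odd_value n := x * r n./2 * even_value n.

(** Odd length a followed by a maximum: the only way to reach nonzero even length. *)
Lemma solve_append a : odd a ->
  even_eq x (even_value a) (odd_value a) 0 0 (even_value a.+1) (odd_value a.+1) /\
  odd_eq x (even_value a) (odd_value a) 0 0 (even_value a.+1) (odd_value a.+1).
Proof.
move=> oa; rewrite /even_eq /odd_eq /odd_value /even_value /= oa /= uphalf_half oa add1n.
have := r_sq a./2.+1; have := rS a./2; move: (r a./2) (r a./2.+1) => A B BA nz.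
have B0 : B != 0 by apply: contra_eq_neq BA => ->; rewrite mul0r eq_sym oner_neq0.
(* The recurrence expresses A through B, leaving an identity in x and B alone. *)
have x2A : x ^+ 2 * A = 1 - B^-1.
  have : B^-1 * (B * (1 - x ^+ 2 * A)) = B^-1 by rewrite BA mulr1.
  by rewrite mulKf // => <-; ring.
split.
  transitivity (1 + (x ^+ 2 * A) * (B / (1 + x ^+ 2 * B ^+ 2))
    - x * (x * B * (B / (1 + x ^+ 2 * B ^+ 2)))); last by ring.
  by rewrite x2A; field; rewrite exprMn nz B0.
transitivity (x * ((x ^+ 2 * A) * (B * (B / (1 + x ^+ 2 * B ^+ 2)))
  + B / (1 + x ^+ 2 * B ^+ 2))); last by ring.
by rewrite x2A; field; rewrite exprMn nz B0.
Qed.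

Lemma solve_odd a b : odd a -> odd b -> let c := (a + b).+1 in
  even_eq x (even_value a) (odd_value a) (even_value b) (odd_value b)
    (even_value c) (odd_value c) /\
  odd_eq x (even_value a) (odd_value a) (even_value b) (odd_value b)
    (even_value c) (odd_value c).
Proof.
move=> oa ob /=; rewrite /even_eq /odd_eq /odd_value /even_value /= oddD oa ob /=.
rewrite uphalf_half oddD halfD oa ob /= add0n add1n.
have := ratio_addS r0 rS a./2 b./2; move: (r _.+1) (r a./2) (r b./2) => C A B H.
split; first by ring.
transitivity (x * (1 - x ^+ 2 * A * B) + x * C * (x ^+ 2 * A + x ^+ 2 * B)); last by ring.
by rewrite -H; ring.
Qed.

Lemma solve_even a b : ~~ odd a -> ~~ odd b -> let c := (a + b).+1 in
  even_eq x (even_value a) (odd_value a) (even_value b) (odd_value b)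
    (even_value c) (odd_value c) /\
  odd_eq x (even_value a) (odd_value a) (even_value b) (odd_value b)
    (even_value c) (odd_value c).
Proof.
move=> oa ob /=; rewrite /even_eq /odd_eq /odd_value /even_value /= oddD.
rewrite (negbTE oa) (negbTE ob) /=.
rewrite uphalf_half oddD halfD (negbTE oa) (negbTE ob) /= !add0n.
have := ratio_add r0 rS a./2 b./2; have := r_sq a./2; have := r_sq b./2.
move: (r (_ + _)) (r a./2) (r b./2) => C A B nB nA H.
set D := (1 + x ^+ 2 * A ^+ 2) * (1 + x ^+ 2 * B ^+ 2).
have H0 : C * (1 - x ^+ 2 * A * B) - (A + B - A * B) = 0 by rewrite H subrr.
split.
  (* The difference of the two sides is a multiple of the addition formula. *)
  transitivity (1 + x ^+ 2 * (B - A) / D *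
    (C * (1 - x ^+ 2 * A * B) - (A + B - A * B))); first by rewrite H0 mulr0 addr0.
  by rewrite /D; field; rewrite !exprMn nA nB.
transitivity (x * C - x * (1 + x ^+ 2 * A * B) / D *
  (C * (1 - x ^+ 2 * A * B) - (A + B - A * B))).
  by rewrite H0 mulr0 subr0 mulr1.
by rewrite /D; field; rewrite !exprMn nA nB.
Qed.
End Solution.

Lemma expands_total t : odd_wedge_word t ->
  expands (total_series t) (Rcheb (size t) sqrtx).
Proof.
elim=> [|a l r _ IHa _ IHr al rl ar sr _].
  have -> : total_series [::] = 0 by apply: seriesP => n; apply: weighted_count_nil.
  exact: expands0.
have rec := total_series_rec al rl ar sr.
set T := total_series (a ++ l :: r) in rec *.
have denE : (1 - X * total_series a - X * total_series r) * T =
    1 - X * total_series a * total_series r.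
  by move/eqP: rec; rewrite -subr_eq0 => /eqP rec; rewrite -[RHS]addr0 -rec; ring.
have hd : expands (1 - X * total_series a - X * total_series r)
    (1 - varx * Rcheb (size a) sqrtx - varx * Rcheb (size r) sqrtx).
  by expands_ring.
have d0 : scoef (1 - X * total_series a - X * total_series r) 0 != 0.
  by rewrite !(scoefD, scoefN, scoefXM0, scoef1) eqxx oppr0 !addr0 oner_neq0.
have hn : expands (1 - X * total_series a * total_series r)
    (1 - varx * Rcheb (size a) sqrtx * Rcheb (size r) sqrtx) by expands_ring.
have := expands_div hd d0 hn denE.
rewrite size_cat /= addnS -(ratio_addS (r := Rcheb ^~ sqrtx) (erefl _) RchebS_sqrtx).
by rewrite mulfK // (expands_neq0 hd).
Qed.

(** The parity condition on t l r leaves exactly the three cases solved above. *)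
Lemma expands_parts t : odd_wedge_word t ->
  expands (even_series t) (even_value varx (Rcheb ^~ varx) (size t)) /\
  expands (odd_series t) (odd_value varx (Rcheb ^~ varx) (size t)).
Proof.
have nil : expands (even_series [::]) 0 /\ expands (odd_series [::]) 0.
  have -> : even_series [::] = 0.
    by apply: seriesP => n /=; rewrite weighted_count_nil if_same.
  have -> : odd_series [::] = 0.
    by apply: seriesP => n /=; rewrite weighted_count_nil if_same.
  by split; apply: expands0.
elim=> [|a l r _ [IHae IHao] _ [IHre IHro] al rl ar sr par].
  by rewrite /odd_value /even_value /= mul0r mulr0.
have recE := even_series_rec al rl ar sr; have recO := odd_series_rec al rl ar sr.
rewrite size_cat /= addnS.
have [oa|oa] := boolP (odd (size a)); have [or_|or_] := boolP (odd (size r)).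
- have [fE fO] := solve_odd (r := Rcheb ^~ varx) (erefl _) RchebS_varx oa or_.
  exact: (expands_cramer IHae IHao IHre IHro recE recO fE fO).
- move: par; rewrite oddD oa (negbTE or_) orbF => /nilP r0.
  rewrite r0 /= addn0 in recE recO *; have [ne no] := nil.
  have [fE fO] := solve_append RchebS_varx Rcheb_sq_varx_neq0 oa.
  exact: (expands_cramer IHae IHao ne no recE recO fE fO).
- by move: par; rewrite oddD (negbTE oa) or_ orbF => /nilP r0; rewrite r0 in or_.
- have [fE fO] := solve_even (r := Rcheb ^~ varx) (erefl _) RchebS_varx Rcheb_sq_varx_neq0 oa or_.
  exact: (expands_cramer IHae IHao IHre IHro recE recO fE fO).
Qed.

Lemma weighted_count_perm b l (t : 'S_l) n : weighted_count b (word t) n =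
  \sum_(s : 'S_n | avoids p132 s && avoids t s) (-1) ^+ (b && odd_perm s).
Proof.
rewrite /weighted_count /av132 big_filter -(perm_big _ (words_permutations n)) big_map /=.
rewrite big_enum_cond /= [RHS]big_mkcondr /=; apply: eq_big => s.
  by rewrite /avoids containsE word132.
move=> _; rewrite /weight /avoids containsE odd_perm_inversions -signr_odd oddM.
by case: b; case: ifP => _; rewrite ?mul1r ?mul0r.
Qed.

Lemma poly_at_xC c : poly_at_x c%:P = tofrac c%:P.
Proof. by rewrite /poly_at_x comp_polyC. Qed.

Lemma series_eq_half (a b : series rat) (f g : Qsqrtx) (u : nat -> rat) :
  expands a f -> expands b g -> (forall n, u n = 1 / 2 * (scoef a n + scoef b n)) ->
  series_eq u (1 / 2 * (f + g)).
Proof.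
move=> ha hb E.
have -> : u = scoef (pser (1 / 2)%:P * (a + b)) by apply/funext => n; rewrite scoefCM scoefD E.
have -> : 1 / 2 = poly_at_x (1 / 2)%:P :> Qsqrtx.
  rewrite poly_at_xC.
  have two := Qsqrtx_two_neq0.
  have twoE : 2 = tofrac 2%:P :> Qsqrtx by rewrite !rmorph_nat.
  apply: (mulIf two); rewrite divfK // [X in _ = _ * X]twoE -tofracM -polyCM divfK //.
apply: expandsM; [exact: expands_pser | exact: expandsD].
Qed.

Theorem corollary2p26 (k : nat) (t : 'S_((2 * k + 1)%N))
    (t_avoids_132 : avoids p132 t) (t_odd_wedge : odd_wedge_pattern t) :
  series_eq (evenGF t)
    (1 / 2 * (Rcheb (2 * k + 1)%N sqrtx + varx * Rcheb k varx + 1)) /\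
  series_eq (oddGF t)
    (1 / 2 * (Rcheb (2 * k + 1)%N sqrtx - varx * Rcheb k varx - 1)).
Proof.
have tw := odd_wedge_pattern_word t_odd_wedge.
have ht := expands_total tw; have [he ho] := expands_parts tw.
have st : size (word t) = (2 * k + 1)%N by rewrite size_map size_enum_ord.
have ot : odd (2 * k + 1) by rewrite oddD oddM.
have hk : (2 * k + 1)./2 = k by rewrite addn1 mul2n /= uphalf_double.
rewrite st in ht he ho; rewrite /odd_value /even_value ot hk mulr1 in he ho.
have hm := expandsD ho he.
have signE n : scoef (odd_series (word t) + even_series (word t)) n =
    weighted_count true (word t) n.
  by rewrite scoefD /=; case: ifP; rewrite ?addr0 ?add0r.
have half (b : bool) : (1 + (-1) ^+ b) = 2 * (~~ b)%:R :> rat by case: b; rewrite /=; ring.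
have half' (b : bool) : (1 - (-1) ^+ b) = 2 * b%:R :> rat by case: b; rewrite /=; ring.
split.
  rewrite -addrA; apply: (series_eq_half ht hm) => n; rewrite signE /= !weighted_count_perm.
  rewrite -big_split /= (eq_bigr _ (fun s _ => half (odd_perm s))) -big_distrr /=.
  rewrite mulrA divfK // mul1r /evenGF -sum1_card natr_sum.
  rewrite [RHS]big_mkcond [LHS]big_mkcond /=; apply: eq_bigr => s _.
  by rewrite inE; case: (avoids _ s); case: (avoids _ s); case: (odd_perm s).
have -> : Rcheb (2 * k + 1) sqrtx - varx * Rcheb k varx - 1 =
    Rcheb (2 * k + 1) sqrtx + - (varx * Rcheb k varx + 1) by rewrite opprD addrA.
apply: (series_eq_half ht (expandsN hm)) => n; rewrite scoefN signE /= !weighted_count_perm.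
rewrite -sumrB (eq_bigr _ (fun s _ => half' (odd_perm s))) -big_distrr /=.
rewrite mulrA divfK // mul1r /oddGF -sum1_card natr_sum.
rewrite [RHS]big_mkcond [LHS]big_mkcond /=; apply: eq_bigr => s _.
by rewrite inE; case: (avoids _ s); case: (avoids _ s); case: (odd_perm s).
Qed.
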